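(* Let $q=6$ and let $\{(\mathbf{u}_h^n,p_h^n)\}_{n=q}^N\subset V_h\times Q_h$ be the solution of the fully discrete BDF-$q$ problem: for $n\ge q$, $$(\bar\partial_q\mathbf{u}_h^n,\mathbf{v}_h)+a(\mathbf{u}_h^n,\mathbf{v}_h)+b(p_h^n,\mathbf{v}_h)=(\mathbf{f}^n,\mathbf{v}_h)\quad\forall \mathbf{v}_h\in V_h,\qquad b(q_h,\mathbf{u}_h^n)-j_h(q_h,p_h^n)=0\quad\forall q_h\in Q_h,$$ with initial values $\mathbf{u}_h^i\in V_h$, $i=0,\ldots,q-1$. Then for $0\le N\tau\le T$, $$\|\mathbf{u}_h^N\|_H^2+\|\mathbf{u}_h^\tau\|_{\ell^2(J_q;V)}^2+|p_h^\tau|_{\ell^2(J_q;j_h)}^2\le C\Bigl[\sum_{i=0}^{q-1}\|\mathbf{u}_h^i\|_H^2+\frac{c_P^2}{\nu}\|\mathbf{f}\|_{\ell^2(J_q;H)}^2\Bigr],$$ with a constant $C>0$ independent of $h$, $N$, $\tau$ and the final time $T$.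
   Context: Continuous setting. $\Omega\subset\mathbb{R}^d$, $d\in\{2,3\}$, is a Lipschitz domain, $J=(0,T)$, $\nu>0$ a constant. $H=[L^2(\Omega)]^d$, $V=[H_0^1(\Omega)]^d$, $Q=L_0^2(\Omega)$ (mean-zero $L^2$ functions), $(\cdot,\cdot)$ is the $L^2$ inner product, $a(\mathbf{u},\mathbf{v})=(\nu\nabla\mathbf{u},\nabla\mathbf{v})$, $b(p,\mathbf{v})=-(p,\nabla\cdot\mathbf{v})$, $\|\mathbf{v}\|_H=(\mathbf{v},\mathbf{v})^{1/2}$, $\|\mathbf{v}\|_V=a(\mathbf{v},\mathbf{v})^{1/2}$, $\|q\|_Q=\|\nu^{-1/2}q\|_{L^2}$. $c_P$ is the Poincaré constant: $\|\mathbf{v}\|_H\le c_P\nu^{-1/2}\|\mathbf{v}\|_V$ for $\mathbf{v}\in V$. $\|\cdot\|_m$ is the $H^m(\Omega)$ norm. Spatial discretization. $\{\mathcal{T}_h\}_{0<h\le1}$ is a quasi-uniform family of triangulations of $\Omega$ with mesh size $h$. With $k\ge1$, $l\ge0$, $k-1\le l\le k$, $V_h=[X_h]^d\cap V$ where $X_h$ is the space of continuous functions that are piecewise polynomial of degree $k$ on $\mathcal{T}_h$; $M_h\subset L^2(\Omega)$ is the space of (possibly discontinuous) piecewise polynomials of degree $l$; and $Q_h=M_h\cap Q$ or $Q_h=M_h\cap Q\cap C^0(\overline\Omega)$. The pressure stabilization $j_h:Q_h\times Q_h\to\mathbb{R}$ is bilinear, symmetric, positive semi-definite, with induced semi-norm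 $|q_h|_{j_h}=j_h(q_h,q_h)^{1/2}$, and $|j_h(p_h,q_h)|\le|p_h|_{j_h}|q_h|_{j_h}\le C\|p_h\|_Q\|q_h\|_Q$ ($j_h=0$ is allowed for inf-sup stable pairs). It is assumed that there are quasi-interpolation operators $\mathcal{I}_h^p:Q\to Q_h$, $\mathcal{I}_h^{\mathbf{u}}:V\to V_h$ with, for $s_p=\min\{s,\bar l,l+1\}$ ($\bar l\ge1$ the order of weak consistency of $j_h$) and $r_{\mathbf{u}}=\min\{r,k+1\}$: - $|\mathcal{I}_h^pq|_{j_h}\le C\nu^{-1/2}h^{s_p}\|q\|_{s_p}$ for $q\in Q\cap H^s(\Omega)$, and $\|q-\mathcal{I}_h^pq\|_Q\le C\nu^{-1/2}h^{l+1}\|q\|_{l+1}$ for $q\in Q\cap H^{l+1}(\Omega)$; - $\|\mathbf{v}-\mathcal{I}_h^{\mathbf{u}}\mathbf{v}\|_H+h\nu^{-1/2}\|\mathbf{v}-\mathcal{I}_h^{\mathbf{u}}\mathbf{v}\|_V\le C h^{r_{\mathbf{u}}}\|\mathbf{v}\|_{r_{\mathbf{u}}}$ for $\mathbf{v}\in V\cap[H^r(\Omega)]^d$; - $|b(q_h,\mathbf{v}-\mathcal{I}_h^{\mathbf{u}}\mathbf{v})|\le C|q_h|_{j_h}\bigl(\nu^{1/2}\|h^{-1}(\mathbf{v}-\mathcal{I}_h^{\mathbf{u}}\mathbf{v})\|_H+\|\mathbf{v}-\mathcal{I}_h^{\mathbf{u}}\mathbf{v}\|_V\bigr)$ for $(q_h,\mathbf{v})\in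 Q_h\times V$. These constants are independent of $h$. The assumptions imply (known result) the modified inf-sup condition $\beta\|q_h\|_Q\le\sup_{\mathbf{v}_h\in V_h}\frac{|b(q_h,\mathbf{v}_h)|}{\|\mathbf{v}_h\|_V}+C|q_h|_{j_h}$ for all $q_h\in Q_h$, with $\beta,C>0$ independent of $h$ and $\nu$. Time discretization. $t_n=n\tau$, $n=0,\ldots,N$, $\tau=T/N$. The BDF-$q$ discrete derivative is $\bar\partial_q\mathbf{w}^n=\frac1\tau\sum_{i=0}^q\delta_i\mathbf{w}^{n-i}$ for $n\ge q$, with $\delta_i$ defined by $\sum_{i=0}^q\delta_i\zeta^i=\sum_{m=1}^q\frac1m(1-\zeta)^m$. $\mathbf{f}\in C^0([0,T];[L^2(\Omega)]^d)$ and $\mathbf{f}^n=\mathbf{f}(t_n)$. $J_q=(t_q,T)$, and for a sequence $w^\tau=(w^n)_{n=q}^N$, $\|w^\tau\|_{\ell^2(J_q;\mathcal{H})}^2=\tau\sum_{n=q}^N\|w^n\|_{\mathcal{H}}^2$; likewise $|p^\tau|_{\ell^2(J_q;j_h)}^2=\tau\sum_{n=q}^N|p^n|_{j_h}^2$; $\|\mathbf{f}\|_{\ell^2(J_q;H)}$ uses the values $\mathbf{f}^n$. *)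

(* Defs.v *)
From HB Require Import structures.
From mathcomp Require Import all_boot all_order all_algebra.
From mathcomp Require Import all_classical all_reals all_analysis.
From mathcomp Require Import measurable_realfun.

Set Implicit Arguments.
Unset Strict Implicit.
Unset Printing Implicit Defensive.

Import Order.TTheory GRing.Theory Num.Theory.
Import numFieldNormedType.Exports.

Local Open Scope classical_set_scope.
Local Open Scope ring_scope.

Fact mx_borel_display : measure_display.
Proof. exact: default_measure_display. Qed.

Section borel_matrix.
Context (R : realType) (m n : nat).

(* The Borel sigma-algebra; the topology on matrices is that of the sup norm. *)
Definition mx_borel : set (set 'M[R]_(m, n)) := <<s @open 'M[R]_(m, n) >>.

HB.instance Definition _ := @isMeasurable.Build mx_borel_display 'M[R]_(m, n)
  mx_borel (@sigma_algebra0 _ setT _) (@sigma_algebraC _ _)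
  (@sigma_algebra_bigcup _ setT _).

Lemma open_measurable_mx (U : set 'M[R]_(m, n)) : open U -> measurable U.
Proof. by move=> oU; apply: sub_sigma_algebra. Qed.

Lemma open_rat_ballsE (U : set 'M[R]_(m, n)) : open U ->
  U = \bigcup_(c in [set c : 'M[rat]_(m, n) * nat |
        ball (map_mx ratr c.1 : 'M[R]_(m, n)) c.2.+1%:R^-1 `<=` U])
      ball (map_mx ratr c.1 : 'M[R]_(m, n)) c.2.+1%:R^-1.
Proof.
move=> oU; apply/seteqP; split=> [x Ux|x [c cU /cU//]].
have /nbhs_ballP[e /= e0 xeU] : nbhs x U by exact: open_nbhs_nbhs.
have [k ke] : exists k : nat, k.+1%:R^-1 < e / 2.
  have [k] := ltr_add_invr (divr_gt0 e0 (ltr0n R 2)).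
  by rewrite add0r; exists k.
have k0 : 0 < (k.+1%:R^-1 : R) by rewrite invr_gt0 ltr0n.
have q i j : {r : rat | `|x i j - ratr r| < k.+1%:R^-1}.
  apply/cid.
  have [r] := rat_in_itvoo (ltr_pwDr k0 (lexx (x i j))).
  rewrite in_itv/= => /andP[xr rx]; exists r.
  by rewrite distrC ger0_norm ?subr_ge0 ?ltW// ltrBlDl.
pose c : 'M[rat]_(m, n) := \matrix_(i, j) sval (q i j).
have cx : ball (map_mx ratr c : 'M[R]_(m, n)) k.+1%:R^-1 x.
  split=> // i j; rewrite !mxE /ball/= distrC; exact: (svalP (q i j)).
exists (c, k) => //= y cy; apply: xeU.
have := ball_triangle (ball_sym cx) cy; apply: le_ball.
by rewrite [leRHS](splitr e) lerD// ltW.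
Qed.

End borel_matrix.

Section lebesgue_rV.
Context (R : realType).

Definition rV_cons n (z : 'rV[R]_n * R) : 'rV[R]_n.+1 :=
  row_mx (z.2)%:M z.1 : 'rV_(1 + n).

Lemma measurable_rV_cons n : measurable_fun setT (@rV_cons n).
Proof.
apply: (measurability (@open 'rV[R]_n.+1)) => //.
move=> _ [U oU <-]; rewrite setTI (open_rat_ballsE oU) preimage_bigcup.
rewrite bigcup_mkcond; apply: countable_bigcupT_measurable => // -[c k].
case: ifPn => _; last exact: measurable0.
set e := _^-1; set a := map_mx _ _.
have -> : @rV_cons n @^-1` ball (a : 'rV[R]_n.+1) e =
    \bigcap_(j in [set: 'I_n.+1])
      [set z | ball (a 0 j) e (@rV_cons n z 0 j)].
  apply/seteqP; split=> [z [_ +] j _|z za] /=; first exact.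
  by split=> [|i j]; [rewrite invr_gt0 ltr0n | rewrite ord1; exact: za].
apply: fin_bigcap_measurable => // j _.
rewrite (_ : [set z | _] = (fun z => rV_cons z 0 j) @^-1` ball (a 0 j) e)//.
have mj : measurable_fun setT (fun z : 'rV[R]_n * R => rV_cons z 0 j).
  have [j0|j1] := eqVneq j 0.
    rewrite (_ : (fun z => _) = snd); first exact: measurable_snd.
    apply/funext => z; rewrite (_ : j = lshift n (0 : 'I_1)).
      by rewrite [LHS]row_mxEl mxE eqxx.
    by rewrite j0; apply/val_inj.
  have jE : j = rshift 1 (Ordinal (ltac:(rewrite -ltnS prednK ?lt0n ?ltn_ord//) : j.-1 < n)%N).
    by apply/val_inj => /=; rewrite add1n prednK// lt0n.
  rewrite jE; set i := Ordinal _.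
  rewrite (_ : (fun z => _) = (fun x : 'rV[R]_n => x 0 i) \o fst); last first.
    by apply/funext => z /=; rewrite [LHS]row_mxEr.
  apply: measurableT_comp; last exact: measurable_fst.
  apply: (measurability _ (@RGenOInfty.measurableE R)).
  move=> _ [_ [a1 ->] <-]; rewrite setTI; apply: open_measurable_mx.
  by apply: open_comp => // x _; exact: coord_continuous.
rewrite -[X in measurable X]setTI; apply: mj => //; exact: measurable_ball.
Qed.

(* The image on R^(n+1) of the product of m and the Lebesgue measure of R. *)
Definition lebesgue_rVS n (m : {measure set 'rV[R]_n -> \bar R}) :=
  pushforward (m \x @lebesgue_measure R)%E (@rV_cons n).

HB.instance Definition _ n (m : {measure set 'rV[R]_n -> \bar R}) :=
  Measure.copy (lebesgue_rVS m)
    (measure_function_pushforward__canonical__measure_function_Measure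
       (m \x @lebesgue_measure R)%E (@measurable_rV_cons n)).

Fixpoint lebesgue_rV n : {measure set 'rV[R]_n -> \bar R} :=
  if n is n'.+1 then lebesgue_rVS (lebesgue_rV n') else \d_(0 : 'rV[R]_0).

Lemma measurable_box m n (a b : 'M[R]_(m, n)) :
  measurable [set x : 'M[R]_(m, n) | forall i j, a i j <= x i j <= b i j].
Proof.
set A := mkset _.
have -> : A = \bigcap_(c in [set: 'I_m * 'I_n])
    ((fun x : 'M[R]_(m, n) => x c.1 c.2) @^-1` `[a c.1 c.2, b c.1 c.2]).
  apply/seteqP; split=> [x xab [i j] _ | x xab i j].
    by rewrite /= in_itv; exact: xab.
  by have := xab (i, j) I; rewrite /= in_itv.
rewrite -[X in measurable X]setCK; apply: measurableC; apply: open_measurable_mx.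
apply: closed_openC; apply: closed_bigI => c _.
have cf : {in ~` (fun x : 'M[R]_(m, n) => x c.1 c.2) @^-1`
    `[a c.1 c.2, b c.1 c.2], continuous (fun x : 'M[R]_(m, n) => x c.1 c.2)}.
  by move=> x _; exact: coord_continuous.
by apply: (preimage_closed cf); exact: interval_closed.
Qed.

Lemma lebesgue_rV_box n (a b : 'rV[R]_n) : (forall i j, a i j <= b i j) ->
  lebesgue_rV n [set x : 'rV[R]_n | forall i j, a i j <= x i j <= b i j] =
  (\prod_j (b 0 j - a 0 j))%:E.
Proof.
elim: n => [|n IHn] in a b *=> ab.
  rewrite big_ord0 /= /dirac indicE mem_set//= => i j.
  by case: j.
pose tl (c : 'rV[R]_n.+1) : 'rV[R]_n := \row_j c 0 (lift ord0 j).
rewrite /= /lebesgue_rVS /pushforward.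
have -> : @rV_cons n @^-1` [set x : 'rV[R]_n.+1 | forall i j, a i j <= x i j <= b i j] =
    [set x : 'rV[R]_n | forall i j, tl a i j <= x i j <= tl b i j] `*`
    `[a 0 0, b 0 0]%classic.
  have z0 z : @rV_cons n z 0 0 = z.2.
    rewrite (_ : 0 = lshift n (0 : 'I_1) :> 'I_(1 + n)); last exact/val_inj.
    by rewrite [LHS]row_mxEl mxE eqxx.
  have zS z j : @rV_cons n z 0 (lift ord0 j) = z.1 0 j.
    rewrite (_ : lift ord0 j = rshift 1 j); last exact/val_inj.
    by rewrite [LHS]row_mxEr.
  apply/seteqP; split=> z /=.
    move=> zab; split=> [i j|]; last by rewrite in_itv/= -z0 zab.
    by rewrite !ord1 !mxE -zS zab.
  rewrite in_itv/= => -[zab z2] i j; rewrite ord1.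
  have [k ->|->] := unliftP ord0 j; last by rewrite z0.
  by rewrite zS; have := zab ord0 k; rewrite !mxE.
rewrite product_measure1E//; last exact: measurable_box.
rewrite IHn; last by move=> i j; rewrite !mxE.
rewrite [X in (_ * X)%E](lebesgue_measure_itv `[a 0 0, b 0 0]) /= lte_fin.
rewrite big_ord_recl mulrC EFinM; congr (_ * _)%E.
  by under eq_bigr do rewrite !mxE.
case: ltP => [_|ba]; first by rewrite EFinB.
by rewrite (_ : b 0 0 = a 0 0) ?subrr//; apply/le_anti; rewrite ba ab.
Qed.

End lebesgue_rV.

Section sobolev_spaces.
Context (R : realType) (d : nat).
Local Notation mu := (lebesgue_rV R d).
Implicit Types (Omega : set 'rV[R]_d) (f g phi : 'rV[R]_d -> R).

Definition L2 Omega : set ('rV[R]_d -> R) := [set f : 'rV[R]_d -> R |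
  measurable_fun Omega f /\
  (\int[mu]_(x in Omega) ((f x) ^+ 2)%:E < +oo)%E].

Definition ipL2 Omega f g : R := \int[mu]_(x in Omega) (f x * g x).

Definition normL2 Omega f : R := Num.sqrt (ipL2 Omega f f).

Definition partial (i : 'I_d) phi : 'rV[R]_d -> R :=
  fun x => 'D_(delta_mx 0 i) phi x.

Definition smooth phi : Prop := forall s : seq 'I_d,
  let psi := foldr partial phi s in
  continuous psi /\ forall x i, derivable psi x (delta_mx 0 i).

(* $C_c^\infty(\Omega)$ *)
Definition test_function Omega : set ('rV[R]_d -> R) := [set phi |
  smooth phi /\
  exists K, [/\ compact K, K `<=` Omega & forall x, ~ K x -> phi x = 0]].

(* [H10 Omega v g]: v is in $H^1_0(\Omega)$, the closure of
   $C_c^\infty(\Omega)$ in $H^1(\Omega)$, and g represents its weak gradient.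
   Being an L2-limit of gradients of test functions converging to v, g is
   determined by v up to a null set. *)
Definition H10 Omega (v : 'rV[R]_d -> R) (g : 'I_d -> 'rV[R]_d -> R) : Prop :=
  [/\ L2 Omega v, forall i, L2 Omega (g i) &
      forall e : R, 0 < e -> exists phi, [/\ test_function Omega phi,
        (\int[mu]_(x in Omega) ((v x - phi x) ^+ 2)%:E < e%:E)%E &
        forall i, (\int[mu]_(x in Omega)
          ((g i x - partial i phi x) ^+ 2)%:E < e%:E)%E]].

Definition multi_partial (alpha : 'I_d -> nat) phi : 'rV[R]_d -> R :=
  foldr (fun i psi => iter (alpha i) (partial i) psi) phi (enum 'I_d).

Definition weak_derivative Omega (alpha : 'I_d -> nat) f :
    set ('rV[R]_d -> R) := [set g |
  L2 Omega g /\ forall phi, test_function Omega phi ->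
    ipL2 Omega f (multi_partial alpha phi) =
    (-1) ^+ (\sum_i alpha i) * ipL2 Omega g phi].

Definition Hm Omega (m : nat) : set ('rV[R]_d -> R) := [set f | L2 Omega f /\
  forall alpha : 'I_d -> nat, (\sum_i alpha i <= m)%N ->
    weak_derivative Omega alpha f !=set0].

(* [xget] picks a version of the weak derivative. *)
Definition normHm Omega (m : nat) f : R :=
  Num.sqrt (\sum_(alpha : {ffun 'I_d -> 'I_m.+1} | (\sum_i alpha i <= m)%N)
    normL2 Omega (xget 0 (weak_derivative Omega (val \o alpha) f)) ^+ 2).

End sobolev_spaces.

(* Vector fields are given by their components.  An $H^1$ vector field is a
   pair v = (v.1, v.2) of the field and its weak gradient, where v.2 i j is the
   j-th partial derivative of the component v.1 i. *)
Notation vfield R d := ('I_d -> 'rV[R]_d -> R).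
Notation h1field R d := (vfield R d * ('I_d -> vfield R d))%type.

Section stokes_spaces.
Context (R : realType) (d : nat) (Omega : set 'rV[R]_d) (nu : R).

Definition spaceH : set (vfield R d) := [set v | forall i, L2 Omega (v i)].

Definition spaceV : set (h1field R d) :=
  [set v | forall i, H10 Omega (v.1 i) (v.2 i)].

Definition spaceQ : set ('rV[R]_d -> R) :=
  [set q | L2 Omega q /\ \int[lebesgue_rV R d]_(x in Omega) q x = 0].

Definition ipH (u v : vfield R d) : R := \sum_i ipL2 Omega (u i) (v i).

Definition form_a (u v : h1field R d) : R :=
  \sum_i \sum_j ipL2 Omega (nu *: u.2 i j) (v.2 i j).

Definition divergence (v : h1field R d) : 'rV[R]_d -> R :=
  fun x => \sum_i v.2 i i x.

Definition form_b (p : 'rV[R]_d -> R) (v : h1field R d) : R :=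
  - ipL2 Omega p (divergence v).

Definition normH (v : vfield R d) : R := Num.sqrt (ipH v v).

Definition normV (v : h1field R d) : R := Num.sqrt (form_a v v).

Definition normQ (q : 'rV[R]_d -> R) : R :=
  normL2 Omega ((Num.sqrt nu)^-1 *: q).

Definition poincare_constant (cP : R) : Prop :=
  0 < cP /\ forall v, spaceV v -> normH v.1 <= cP * (Num.sqrt nu)^-1 * normV v.

Definition Hm_field (m : nat) : set (vfield R d) :=
  [set v | forall i, Hm Omega m (v i)].

Definition normHm_field (m : nat) (v : vfield R d) : R :=
  Num.sqrt (\sum_i normHm Omega m (v i) ^+ 2).

End stokes_spaces.

Section geometry.
Context (R : realType) (d : nat).

Definition enorm (x : 'rV[R]_d) : R := Num.sqrt (\sum_i x 0 i ^+ 2).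

(* Domains are bounded.  Near each boundary point, after a change of orthonormal coordinates given by
   O, the domain is the part above the graph of a Lipschitz function of the
   remaining d - 1 coordinates. *)
Definition lipschitz_domain (Omega : set 'rV[R]_d) : Prop :=
  [/\ Omega !=set0, open Omega, connected Omega, bounded_set Omega &
      forall x, (closure Omega `\` Omega) x ->
      exists (U : set 'rV[R]_d) (O : 'M[R]_d) (i : 'I_d)
          (g : 'rV[R]_d.-1 -> R) (L : R),
        [/\ nbhs x U, O *m O^T = 1%:M,
            forall y z, `|g y - g z| <= L * `|y - z| &
            forall z, U z ->
              (Omega z <-> g (col' i (z *m O)) < (z *m O) 0 i)]].

(* The rows of K : 'M[R]_(d.+1, d) are the vertices of a d-simplex. *)
Definition barycentric (lambda : 'rV[R]_d.+1) : Prop :=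
  (forall i, 0 <= lambda 0 i) /\ \sum_i lambda 0 i = 1.

Definition simplex (K : 'M[R]_(d.+1, d)) : set 'rV[R]_d :=
  [set lambda *m K | lambda in barycentric].

(* The convex hull of the vertices of K that are also vertices of K'; it is
   empty if there are none. *)
Definition common_face (K K' : 'M[R]_(d.+1, d)) : set 'rV[R]_d :=
  [set lambda *m K | lambda in [set lambda | barycentric lambda /\
    forall i, (forall j, row i K <> row j K') -> lambda 0 i = 0]].

Definition triangulation (Omega : set 'rV[R]_d)
    (T : seq 'M[R]_(d.+1, d)) : Prop :=
  [/\ forall K, K \in T -> row_free (row_mx (const_mx 1 : 'cV[R]_d.+1) K),
      closure Omega = \bigcup_(K in [set` T]) simplex K &
      forall K K', K \in T -> K' \in T ->
        simplex K `&` simplex K' = common_face K K'].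

(* h bounds all diameters, and each simplex contains a ball of radius
   comparable to h; h is thus the mesh size up to a fixed factor. *)
Definition quasi_uniform (Omega : set 'rV[R]_d)
    (T : R -> seq 'M[R]_(d.+1, d)) : Prop :=
  (forall h, 0 < h <= 1 -> triangulation Omega (T h)) /\
  exists2 c : R, 0 < c & forall h K, 0 < h <= 1 -> K \in T h ->
    (forall x y, simplex K x -> simplex K y -> enorm (x - y) <= h) /\
    exists x, forall y, enorm (y - x) <= c * h -> simplex K y.

End geometry.

Section finite_elements.
Context (R : realType) (d : nat) (Omega : set 'rV[R]_d) (nu : R).
Context (T : seq 'M[R]_(d.+1, d)).

Definition polynomial_function (k : nat) : set ('rV[R]_d -> R) :=
  [set p : 'rV[R]_d -> R |
  exists c : {ffun 'I_d -> 'I_k.+1} -> R, forall x,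
    p x = \sum_(alpha : {ffun 'I_d -> 'I_k.+1} | (\sum_i alpha i <= k)%N)
            c alpha * \prod_i x 0 i ^+ alpha i].

(* Elements of discontinuous spaces are left unconstrained on the null set of
   simplex boundaries. *)
Definition piecewise_polynomial (k : nat) : set ('rV[R]_d -> R) := [set v |
  forall K, K \in T -> exists2 p, polynomial_function k p &
    forall x, (simplex K)° x -> v x = p x].

Definition spaceX (k : nat) : set ('rV[R]_d -> R) := [set v |
  {within closure Omega, continuous v} /\ piecewise_polynomial k v].

Definition spaceM (l : nat) : set ('rV[R]_d -> R) :=
  L2 Omega `&` piecewise_polynomial l.

Definition spaceVh (k : nat) : set (h1field R d) :=
  spaceV Omega `&` [set v | forall i, spaceX k (v.1 i)].

Definition spaceQh (continuous_pressure : bool) (l : nat) :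
    set ('rV[R]_d -> R) :=
  spaceM l `&` spaceQ Omega `&`
  [set q | continuous_pressure -> {within closure Omega, continuous q}].

End finite_elements.

Section stabilization_and_interpolation.
Context (R : realType) (d : nat) (Omega : set 'rV[R]_d) (nu : R).
Implicit Types (p q : 'rV[R]_d -> R) (v : h1field R d).

Definition seminorm_j (j : ('rV[R]_d -> R) -> ('rV[R]_d -> R) -> R) q : R :=
  Num.sqrt (j q q).

Definition pressure_stabilization (Qh : R -> set ('rV[R]_d -> R))
    (j : R -> ('rV[R]_d -> R) -> ('rV[R]_d -> R) -> R) : Prop :=
  [/\ forall h a p p' q, 0 < h <= 1 -> Qh h p -> Qh h p' -> Qh h q ->
        j h (a *: p + p') q = a * j h p q + j h p' q /\
        j h q (a *: p + p') = a * j h q p + j h q p',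
      forall h p q, 0 < h <= 1 -> Qh h p -> Qh h q -> j h p q = j h q p,
      forall h q, 0 < h <= 1 -> Qh h q -> 0 <= j h q q &
      exists2 C : R, 0 < C & forall h p q, 0 < h <= 1 -> Qh h p -> Qh h q ->
        `|j h p q| <= seminorm_j (j h) p * seminorm_j (j h) q <=
        C * normQ Omega nu p * normQ Omega nu q].

Definition quasi_interpolation (k l lbar : nat) (Vh : R -> set (h1field R d))
    (Qh : R -> set ('rV[R]_d -> R))
    (j : R -> ('rV[R]_d -> R) -> ('rV[R]_d -> R) -> R) : Prop :=
  exists (Ip : R -> ('rV[R]_d -> R) -> ('rV[R]_d -> R))
      (Iu : R -> h1field R d -> h1field R d),
    (forall h, 0 < h <= 1 ->
      (forall q, spaceQ Omega q -> Qh h (Ip h q)) /\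
      (forall v, spaceV Omega v -> Vh h (Iu h v))) /\
    exists2 C : R, 0 < C & forall h, 0 < h <= 1 ->
    [/\ forall s q, (0 < s)%N -> spaceQ Omega q -> Hm Omega s q ->
          seminorm_j (j h) (Ip h q) <=
          C * (Num.sqrt nu)^-1 * h ^+ minn s (minn lbar l.+1)
            * normHm Omega (minn s (minn lbar l.+1)) q,
        forall q, spaceQ Omega q -> Hm Omega l.+1 q ->
          normQ Omega nu (q - Ip h q) <=
          C * (Num.sqrt nu)^-1 * h ^+ l.+1 * normHm Omega l.+1 q,
        forall r v, (0 < r)%N -> spaceV Omega v -> Hm_field Omega r v.1 ->
          normH Omega (v - Iu h v).1
            + h * (Num.sqrt nu)^-1 * normV Omega nu (v - Iu h v) <=
          C * h ^+ minn r k.+1 * normHm_field Omega (minn r k.+1) v.1 &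
        forall q v, Qh h q -> spaceV Omega v ->
          `|form_b Omega q (v - Iu h v)| <=
          C * seminorm_j (j h) q *
            (Num.sqrt nu * normH Omega (h^-1 *: (v - Iu h v).1)
             + normV Omega nu (v - Iu h v))].

End stabilization_and_interpolation.

Section bdf.
Context (R : realType) (d : nat) (Omega : set 'rV[R]_d) (nu : R).

Definition bdf_poly (q : nat) : {poly R} :=
  \sum_(1 <= m < q.+1) m%:R^-1 *: (1 - 'X) ^+ m.

Definition bdf_coef (q i : nat) : R := (bdf_poly q)`_i.

Definition bdf_derivative (q : nat) (tau : R) (w : nat -> vfield R d)
    (n : nat) : vfield R d :=
  tau^-1 *: \sum_(i < q.+1) bdf_coef q i *: w (n - i)%N.

Definition continuous_in_H (T : R) (f : R -> vfield R d) : Prop :=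
  (forall t, 0 <= t <= T -> spaceH Omega (f t)) /\
  forall t, 0 <= t <= T ->
    normH Omega (f s - f t) @[s --> within `[0, T] (nbhs t)] --> (0 : R).

Definition bdf_solution (q : nat) (Vh : set (h1field R d))
    (Qh : set ('rV[R]_d -> R)) (jh : ('rV[R]_d -> R) -> ('rV[R]_d -> R) -> R)
    (tau : R) (N : nat) (f : R -> vfield R d)
    (u : nat -> h1field R d) (p : nat -> 'rV[R]_d -> R) : Prop :=
  (forall i, (i < q)%N -> Vh (u i)) /\
  forall n, (q <= n <= N)%N ->
    [/\ Vh (u n), Qh (p n),
        forall v, Vh v ->
          ipH Omega (bdf_derivative q tau (fun m => (u m).1) n) v.1
            + form_a Omega nu (u n) v + form_b Omega (p n) v
          = ipH Omega (f (n%:R * tau)) v.1 &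
        forall r, Qh r -> form_b Omega r (u n) - jh r (p n) = 0].

(* The norm of $\ell^2(J_q; \mathcal H)$, where w n is the norm of the n-th
   term of the sequence. *)
Definition norm_ell2 (q N : nat) (tau : R) (w : nat -> R) : R :=
  Num.sqrt (tau * \sum_(q <= n < N.+1) w n ^+ 2).

End bdf.

(* Main.v *)
(* The pair of the six-step BDF method and the multiplier
   mu(zeta) = 1 - 13/9 zeta + 25/36 zeta^2 - 1/9 zeta^3 of Akrivis, Chen, Yu and
   Zhou satisfies Re (delta conj mu) >= 0 and Re mu > 0 on the unit circle.  By
   the positive real lemma, (delta_q u^n, u^n - 13/9 u^(n-1) + ...) is a
   difference of values of a positive definite form G plus a nonnegative
   remainder, and <u^n, u^n - 13/9 u^(n-1) + ...> is a difference of values of a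
   nonnegative form K plus a coercive remainder; G and K are given by explicit
   rational matrices, so that only finitely many rational inequalities remain to
   be checked on Gram matrices.  For n >= 9 one tests the momentum equation with
   u^n - 13/9 u^(n-1) + 25/36 u^(n-2) - 1/9 u^(n-3), all four of which satisfy
   the discrete continuity equation, which turns b into j_h; summation over n
   telescopes.  The steps n = 6, 7, 8, where this would involve V-norms of the
   initial values, are tested with u^n itself. *)
Require Import Defs.
From mathcomp Require Import all_boot all_order all_algebra.
From mathcomp Require Import all_classical all_reals all_analysis.
From mathcomp Require Import measurable_realfun ring lra zify.

Set Implicit Arguments.
Unset Strict Implicit.
Unset Printing Implicit Defensive.

Import Order.TTheory GRing.Theory Num.Theory.
Import numFieldNormedType.Exports.

Local Open Scope classical_set_scope.
Local Open Scope ring_scope.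

(** * Positive semidefinite Gram matrices *)

(** Stands for the Gram matrix of [m] vectors. Forgetting the vectors makes the energy inequalities
    linear in finitely many reals, so that [lra] applies once numeric test vectors are supplied. *)
Definition psd_kernel (R : realFieldType) (m : nat) (g : nat -> nat -> R) :=
  (forall i j, (i < m)%N -> (j < m)%N -> g i j = g j i) /\
  forall c : nat -> R, 0 <= \sum_(i < m) \sum_(j < m) c i * c j * g i j.

(** Evaluates the quadratic form at a special [b] (sparse, extended by zero, or a difference)
    through the functional [L] it induces, without expanding the double sum. *)
Lemma gram_sumE (R : comNzRingType) m (g : nat -> nat -> R) (b : nat -> R)
    (L : (nat -> R) -> R) :
  (forall f : nat -> R, \sum_(k < m) b k * f k = L f) ->
  \sum_(i < m) \sum_(j < m) b i * b j * g i j = L (fun i => L (g i)).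
Proof.
move=> LE; rewrite -LE; apply: eq_bigr => i _; rewrite -LE mulr_sumr.
by apply: eq_bigr => j _; rewrite mulrA.
Qed.

(** Positivity at the vector a e_i + b e_j; the case [i = j] is allowed and yields the diagonal
    entries. *)
Lemma psd_kernel_young (R : realFieldType) m (g : nat -> nat -> R) i j
    (a b : R) :
  psd_kernel m g -> (i < m)%N -> (j < m)%N ->
  - (2 * a * b * g i j) <= a ^+ 2 * g i i + b ^+ 2 * g j j.
Proof.
move=> [gs gP] im jm.
pose c k := a * (k == i)%:R + b * (k == j)%:R.
have E (f : nat -> R) : \sum_(k < m) c k * f k = a * f i + b * f j.
  have S (k0 : nat) (x : R) : (k0 < m)%N ->
      \sum_(k < m) x * ((k : nat) == k0)%:R * f k = x * f k0.
    move=> k0m; rewrite (bigD1 (Ordinal k0m))//= eqxx mulr1 big1 ?addr0// => k.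
    by rewrite -val_eqE/= => /negPf ->; rewrite mulr0 mul0r.
  by under eq_bigr do rewrite mulrDl; rewrite big_split/= !S.
have := gP c; rewrite (gram_sumE _ E) (gs j i)// => H.
rewrite -subr_ge0; move: H; congr (_ <= _); ring.
Qed.

Lemma psd_kernel_diag (R : realFieldType) m (g : nat -> nat -> R) i :
  psd_kernel m g -> (i < m)%N -> 0 <= g i i.
Proof. by move=> gP im; have := psd_kernel_young 1 0 gP im im; lra. Qed.

Lemma psd_kernel_pair (R : realFieldType) m (g : nat -> nat -> R) i j :
  psd_kernel m g -> (i < m)%N -> (j < m)%N ->
  - (g i i + g j j) / 2 <= g i j <= (g i i + g j j) / 2.
Proof.
move=> gP im jm.
have := psd_kernel_young 1 1 gP im jm.
have := psd_kernel_young 1 (-1) gP im jm.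
by move=> ? ?; apply/andP; split; lra.
Qed.

Lemma psd_kernel_le (R : realFieldType) m m' (g : nat -> nat -> R) :
  (m' <= m)%N -> psd_kernel m g -> psd_kernel m' g.
Proof.
move=> mm [gs gP]; split=> [i j im jm|c].
  by apply: gs; exact: leq_trans mm.
pose b k := if (k < m')%N then c k else 0.
have E (f : nat -> R) : \sum_(k < m) b k * f k = \sum_(k < m') c k * f k.
  rewrite (big_ord_widen _ (fun k => c k * f k) mm) [RHS]big_mkcond.
  by apply: eq_bigr => k _; rewrite /b; case: ifP => //; rewrite mul0r.
have := gP b; rewrite (gram_sumE _ E); congr (_ <= _); apply: eq_bigr => i _.
by rewrite mulr_sumr; apply: eq_bigr => j _; rewrite mulrA.
Qed.

Lemma psd_kernel_sum (R : realFieldType) m (I : Type) (r : seq I) (P : pred I)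
    (g : I -> nat -> nat -> R) :
  (forall i, P i -> psd_kernel m (g i)) ->
  psd_kernel m (fun a b => \sum_(i <- r | P i) g i a b).
Proof.
move=> gP; split=> [a b am bm|c].
  by apply: eq_bigr => i /gP[gs _]; exact: gs.
under eq_bigr do under eq_bigr do rewrite mulr_sumr.
under eq_bigr do rewrite exchange_big/=.
by rewrite exchange_big/=; apply: sumr_ge0 => i /gP[_]; exact.
Qed.

Lemma psd_kernelD (R : realFieldType) m (g g' : nat -> nat -> R) :
  psd_kernel m g -> psd_kernel m g' -> psd_kernel m (fun a b => g a b + g' a b).
Proof.
move=> [gs gP] [gs' gP']; split=> [a b am bm|c].
  by rewrite (gs a b)// (gs' a b).
under eq_bigr do under eq_bigr do rewrite mulrDr.
by under eq_bigr do rewrite big_split/=; rewrite big_split addr_ge0 ?gP ?gP'.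
Qed.

Lemma psd_kernelZ (R : realFieldType) m (x : R) (g : nat -> nat -> R) :
  0 <= x -> psd_kernel m g -> psd_kernel m (fun a b => x * g a b).
Proof.
move=> x0 [gs gP]; split=> [a b am bm|c]; first by rewrite gs.
under eq_bigr do under eq_bigr do rewrite mulrCA.
by under eq_bigr do rewrite -mulr_sumr; rewrite -mulr_sumr mulr_ge0.
Qed.

(** Only entries on and above the diagonal occur, so each numeric choice of [a0], ..., [a5] is one
    linear hypothesis for [lra]. *)
Lemma psd_kernel6 (R : realFieldType) (g : nat -> nat -> R) :
  psd_kernel 6 g -> forall a0 a1 a2 a3 a4 a5 : R,
  0 <= a0 ^+ 2 * g 0 0 + a1 ^+ 2 * g 1 1 + a2 ^+ 2 * g 2 2
     + a3 ^+ 2 * g 3 3 + a4 ^+ 2 * g 4 4 + a5 ^+ 2 * g 5 5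
     + 2 * (a0 * a1 * g 0 1 + a0 * a2 * g 0 2 + a0 * a3 * g 0 3
     + a0 * a4 * g 0 4 + a0 * a5 * g 0 5 + a1 * a2 * g 1 2 + a1 * a3 * g 1 3
     + a1 * a4 * g 1 4 + a1 * a5 * g 1 5 + a2 * a3 * g 2 3 + a2 * a4 * g 2 4
     + a2 * a5 * g 2 5 + a3 * a4 * g 3 4 + a3 * a5 * g 3 5 + a4 * a5 * g 4 5).
Proof.
move=> [gs gP] a0 a1 a2 a3 a4 a5.
have := gP (nth 0 [:: a0; a1; a2; a3; a4; a5]).
rewrite !big_ord_recr !big_ord0 /=.
rewrite (gs 1 0)// (gs 2 0)// (gs 3 0)// (gs 4 0)// (gs 5 0)// (gs 2 1)//.
rewrite (gs 3 1)// (gs 4 1)// (gs 5 1)// (gs 3 2)// (gs 4 2)// (gs 5 2)//.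
rewrite (gs 4 3)// (gs 5 3)// (gs 5 4)//.
by congr (_ <= _); ring.
Qed.

Lemma psd_kernel4 (R : realFieldType) (g : nat -> nat -> R) :
  psd_kernel 4 g -> forall a0 a1 a2 a3 : R,
  0 <= a0 ^+ 2 * g 0 0 + a1 ^+ 2 * g 1 1 + a2 ^+ 2 * g 2 2 + a3 ^+ 2 * g 3 3
     + 2 * (a0 * a1 * g 0 1 + a0 * a2 * g 0 2 + a0 * a3 * g 0 3
     + a1 * a2 * g 1 2 + a1 * a3 * g 1 3 + a2 * a3 * g 2 3).
Proof.
move=> [gs gP] a0 a1 a2 a3; have := gP (nth 0 [:: a0; a1; a2; a3]).
rewrite !big_ord_recr !big_ord0 /=.
rewrite (gs 1 0)// (gs 2 0)// (gs 3 0)// (gs 2 1)// (gs 3 1)// (gs 3 2)//.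
by congr (_ <= _); ring.
Qed.

(** The Gram matrix of the differences v_i - v_(i+1), which are backward differences since indices
    count steps back in time. *)
Lemma psd_kernel_diff (R : realFieldType) m (g : nat -> nat -> R) :
  psd_kernel m.+1 g ->
  psd_kernel m (fun i j => g i j - g i.+1 j - g i j.+1 + g i.+1 j.+1).
Proof.
move=> [gs gP]; split=> [i j im jm|c].
  rewrite (gs i j) ?ltnS 1?ltnW// (gs i.+1 j)// 1?ltnW//.
  by rewrite (gs i j.+1)// 1?ltnW// (gs i.+1 j.+1)//; ring.
(* The transposed difference operator: b_k = c_k - c_(k-1), with the conventions c_(-1) = c_m =
   0. *)
pose b k := (if k is k'.+1 then - c k' else 0) + (if (k < m)%N then c k else 0).
have E (f : nat -> R) :
    \sum_(k < m.+1) b k * f k = \sum_(k < m) c k * (f k - f k.+1).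
  under eq_bigr do rewrite mulrDl.
  rewrite big_split/= big_ord_recl mul0r add0r big_ord_recr/= ltnn mul0r addr0.
  rewrite -big_split; apply: eq_bigr => k _.
  by rewrite /= ltn_ord; ring.
have := gP b; rewrite (gram_sumE _ E).
congr (_ <= _); apply: eq_bigr => k _.
rewrite -sumrB mulr_sumr; apply: eq_bigr => l _; ring.
Qed.

(** * Rational matrix inequalities for the BDF6 multiplier *)

(* G is a rounded analytic centre of the linear matrix inequalities expressing
   bdf6_multiplier_ge and positive definiteness. *)
Definition Gform (R : realFieldType) (g : nat -> nat -> R) : R :=
  541 / 240 * g 0 0 + 193 / 20 * g 1 1 + 457 / 40 * g 2 2 + 43 / 6 * g 3 3
  + 361 / 120 * g 4 4 + 31 / 60 * g 5 5
  + 2 * (- 1247 / 288 * g 0 1 + 1159 / 288 * g 0 2 - 2431 / 864 * g 0 3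
    + 2909 / 2160 * g 0 4 - 673 / 2160 * g 0 5 - 1183 / 120 * g 1 2
    + 69 / 10 * g 1 3 - 85 / 24 * g 1 4 + 14 / 15 * g 1 5
    - 1021 / 120 * g 2 3 + 181 / 40 * g 2 4 - 4 / 3 * g 2 5
    - 503 / 120 * g 3 4 + 151 / 120 * g 3 5 - 43 / 40 * g 4 5).

Definition Kform (R : realFieldType) (g : nat -> nat -> R) : R :=
  109 / 120 * g 0 0 + 67 / 120 * g 1 1 + 7 / 40 * g 2 2
  + 2 * (- 7 / 12 * g 0 1 + 5 / 24 * g 0 2 - 9 / 40 * g 1 2).

(** Here [x i] is the value [i] steps back; the factor 1/tau is left out. *)
Definition bdf6 (R : realFieldType) (x : nat -> R) : R :=
  147 / 60 * x 0 - 6 * x 1 + 15 / 2 * x 2 - 20 / 3 * x 3 + 15 / 4 * x 4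
  - 6 / 5 * x 5 + 1 / 6 * x 6.

Definition multiplier (R : realFieldType) (x : nat -> R) : R :=
  x 0 - 13 / 9 * x 1 + 25 / 36 * x 2 - 1 / 9 * x 3.

(** This form is the remainder in [bdf6_multiplier_ge], written in the six backward differences. *)
Lemma bdf6_remainder_ge0 (R : realFieldType) (d : nat -> nat -> R) :
  psd_kernel 6 d ->
  0 <= 47 / 240 * d 0 0 + 47 / 80 * d 1 1 + 443 / 360 * d 2 2 + 13 / 10 * d 3 3
     + 103 / 120 * d 4 4 + 31 / 60 * d 5 5
     + 2 * (- 39 / 160 * d 0 1 + 479 / 1440 * d 0 2 - 349 / 1080 * d 0 3
       + 443 / 2160 * d 0 4 - 1 / 12 * d 0 5 - 1163 / 1440 * d 1 2
       + 233 / 288 * d 1 3 - 463 / 720 * d 1 4 + 251 / 720 * d 1 5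
       - 1333 / 1080 * d 2 3 + 107 / 108 * d 2 4 - 347 / 540 * d 2 5
       - 1 * d 3 4 + 7 / 10 * d 3 5 - 67 / 120 * d 4 5).
Proof.
(* The vectors are rounded columns of an L D L^T factorization; the bounds S on
   the off-diagonal entries absorb the rounding errors. *)
move=> dP; have Q := psd_kernel6 dP.
have := Q 174 (-220) 300 (-291) 185 (-75).
have := Q 0 207 (-290) 300 (-287) 182.
have := Q 0 0 212 (-220) 189 (-300).
have := Q 0 0 0 300 15 239.
have := Q 0 0 0 0 300 119.
have := Q 0 0 0 0 0 1.
have S i j : (i < 6)%N -> (j < 6)%N -> _ := @psd_kernel_pair _ _ _ i j dP.
have := S 0 1 isT isT; have := S 0 2 isT isT; have := S 0 3 isT isT.
have := S 0 4 isT isT; have := S 0 5 isT isT; have := S 1 2 isT isT.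
have := S 1 3 isT isT; have := S 1 4 isT isT; have := S 1 5 isT isT.
have := S 2 3 isT isT; have := S 2 4 isT isT; have := S 2 5 isT isT.
have := S 3 4 isT isT; have := S 3 5 isT isT; have := S 4 5 isT isT.
clear; lra.
Qed.

Lemma bdf6_multiplier_ge (R : realFieldType) (g : nat -> nat -> R) :
  psd_kernel 7 g ->
  Gform g - Gform (fun i j => g i.+1 j.+1) <=
  multiplier (fun j => bdf6 (fun i => g i j)).
Proof.
(* As delta(1) = 0, the remainder depends only on the backward differences. *)
move=> gP; have [gs _] := gP; rewrite -subr_ge0.
have := bdf6_remainder_ge0 (psd_kernel_diff gP).
rewrite /multiplier /bdf6 /Gform.
have S i j : (i < 7)%N -> (j < 7)%N -> _ := gs i j.
have := S 1 0 isT isT; have := S 2 0 isT isT; have := S 2 1 isT isT.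
have := S 3 0 isT isT; have := S 3 1 isT isT; have := S 3 2 isT isT.
have := S 4 0 isT isT; have := S 4 1 isT isT; have := S 4 2 isT isT.
have := S 4 3 isT isT; have := S 5 0 isT isT; have := S 5 1 isT isT.
have := S 5 2 isT isT; have := S 5 3 isT isT; have := S 5 4 isT isT.
have := S 6 0 isT isT; have := S 6 1 isT isT; have := S 6 2 isT isT.
have := S 6 3 isT isT; have := S 6 4 isT isT; have := S 6 5 isT isT.
clear; lra.
Qed.

(** Recovers the H-norm of the newest value from G. The test vectors are rounded columns of a
    triangular factorization eliminating the last index first; [S] absorbs the rounding. *)
Lemma Gform_coercive (R : realFieldType) (g : nat -> nat -> R) :
  psd_kernel 6 g -> g 0 0 / 40 <= Gform g.
Proof.
move=> gP; have Q := psd_kernel6 gP; rewrite /Gform.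
have := Q (-304) 910 (-1300) 1227 (-1048) 501.
have := Q 520 (-1190) 1300 (-1168) 567 0.
have := Q (-483) 1045 (-1300) 678 0 0.
have := Q 463 (-1300) 836 0 0 0.
have := Q (-1300) 1251 0 0 0 0.
have := Q 1 0 0 0 0 0.
have S i j : (i < 6)%N -> (j < 6)%N -> _ := @psd_kernel_pair _ _ _ i j gP.
have := S 0 1 isT isT; have := S 0 2 isT isT; have := S 0 3 isT isT.
have := S 0 4 isT isT; have := S 0 5 isT isT; have := S 1 2 isT isT.
have := S 1 3 isT isT; have := S 1 4 isT isT; have := S 1 5 isT isT.
have := S 2 3 isT isT; have := S 2 4 isT isT; have := S 2 5 isT isT.
have := S 3 4 isT isT; have := S 3 5 isT isT; have := S 4 5 isT isT.
clear; lra.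
Qed.

(** The factor 40 rounds up the largest absolute row sum of the matrix, about 39.7 in row 2. *)
Lemma Gform_bounded (R : realFieldType) (g : nat -> nat -> R) :
  psd_kernel 6 g -> Gform g <= 40 * \sum_(i < 6) g i i.
Proof.
move=> gP; rewrite /Gform !big_ord_recr big_ord0/=.
have S i j : (i < 6)%N -> (j < 6)%N -> _ := @psd_kernel_pair _ _ _ i j gP.
have := S 0 1 isT isT; have := S 0 2 isT isT; have := S 0 3 isT isT.
have := S 0 4 isT isT; have := S 0 5 isT isT; have := S 1 2 isT isT.
have := S 1 3 isT isT; have := S 1 4 isT isT; have := S 1 5 isT isT.
have := S 2 3 isT isT; have := S 2 4 isT isT; have := S 2 5 isT isT.
have := S 3 4 isT isT; have := S 3 5 isT isT; have := S 4 5 isT isT.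
have D i : (i < 6)%N -> _ := @psd_kernel_diag _ _ _ i gP.
have := D 0 isT; have := D 1 isT; have := D 2 isT; have := D 3 isT.
have := D 4 isT; have := D 5 isT.
clear; lra.
Qed.

(** The coercive term covers all four diagonal entries because the forcing is later tested with all
    four values. The test vectors are the exact columns of an L D L^T factorization. *)
Lemma Kform_multiplier_ge (R : realFieldType) (g : nat -> nat -> R) :
  psd_kernel 4 g ->
  Kform g - Kform (fun i j => g i.+1 j.+1) + (\sum_(i < 4) g i i) / 200 <=
  multiplier (g 0).
Proof.
move=> gP; have Q := psd_kernel4 gP.
rewrite /multiplier /Kform !big_ord_recr big_ord0/=.
have := Q 78 (-125) 125 (-50); have := Q 0 8594 (-9530) 8375.
have := Q 0 0 6722 (-4735); have := Q 0 0 0 1.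
clear; lra.
Qed.

Lemma Kform_ge0 (R : realFieldType) (g : nat -> nat -> R) :
  psd_kernel 4 g -> 0 <= Kform g.
Proof.
move=> gP; have Q := psd_kernel4 gP; rewrite /Kform.
have := Q 109 (-70) 25 0; have := Q 0 2403 (-1193) 0; have := Q 0 0 1 0.
clear; lra.
Qed.

Lemma Kform_bounded (R : realFieldType) (g : nat -> nat -> R) :
  psd_kernel 3 g -> Kform g <= 2 * \sum_(i < 3) g i i.
Proof.
move=> gP; rewrite /Kform !big_ord_recr big_ord0/=.
have S i j : (i < 3)%N -> (j < 3)%N -> _ := @psd_kernel_pair _ _ _ i j gP.
have := S 0 1 isT isT; have := S 0 2 isT isT; have := S 1 2 isT isT.
have D i : (i < 3)%N -> _ := @psd_kernel_diag _ _ _ i gP.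
have := D 0 isT; have := D 1 isT; have := D 2 isT.
clear; lra.
Qed.

(** * The discrete energy estimate for abstract Gram arrays *)

(** Reads an array backwards from step [n]. Subtraction truncates, so for small [n] index 0 repeats;
    a Gram matrix with repeated vectors is still positive semidefinite. *)
Definition window (R : realFieldType) (g : nat -> nat -> R) (n i j : nat) :=
  g (n - i)%N (n - j)%N.

Lemma window_pred (R : realFieldType) (g : nat -> nat -> R) n i j :
  window g n i.+1 j.+1 = window g n.-1 i j.
Proof. by rewrite /window !subnS !predn_sub. Qed.

(** The equation of step [n], tested with the values 0 to 3 steps back, is combined by [multiplier].
    Half of the 1/200 dissipation from [Kform_multiplier_ge] absorbs the forcing; the other half
    remains. *)
Lemma bdf6_energy_step (R : realFieldType) (n : nat) (tau phi : R)
    (H B : nat -> nat -> R) (F : nat -> R) :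
  0 < tau -> 0 <= phi ->
  psd_kernel 7 (window H n) -> psd_kernel 4 (window B n) ->
  (forall j, (j < 4)%N ->
     tau^-1 * bdf6 (fun i => window H n i j) + window B n 0 j = F j) ->
  (forall j x, (j < 4)%N ->
     x * F j <= window B n j j / 400 + 100 * x ^+ 2 * phi) ->
  Gform (window H n) + tau * Kform (window B n) + tau / 400 * B n n <=
  Gform (window H n.-1) + tau * Kform (window B n.-1) + 400 * (tau * phi).
Proof.
move=> tau0 phi0 HP BP eqF leF.
have GE : Gform (window H n.-1) = Gform (fun i j => window H n i.+1 j.+1).
  by congr Gform; apply/funext => i; apply/funext => j; rewrite window_pred.
have KE : Kform (window B n.-1) = Kform (fun i j => window B n i.+1 j.+1).
  by congr Kform; apply/funext => i; apply/funext => j; rewrite window_pred.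
have BnE : B n n = window B n 0 0 by rewrite /window subn0.
rewrite GE KE BnE.
have G1 := bdf6_multiplier_ge HP.
have K1 := Kform_multiplier_ge BP.
have M1 : multiplier (fun j => bdf6 (fun i => window H n i j)) =
    tau * (multiplier F - multiplier (window B n 0)).
  have E j : (j < 4)%N ->
      bdf6 (fun i => window H n i j) = tau * (F j - window B n 0 j).
    by move=> j4; rewrite -eqF// addrK mulrA divff ?mul1r// gt_eqF.
  by rewrite /multiplier !E//; ring.
(* The squared multiplier coefficients add up to about 3.6, hence 400 in place of 100. *)
have F1 : multiplier F <= (\sum_(i < 4) window B n i i) / 400 + 400 * phi.
  rewrite /multiplier !big_ord_recr big_ord0/=.
  have := leF 0%N 1 isT; have := leF 1%N (- (13 / 9)) isT.
  have := leF 2%N (25 / 36) isT; have := leF 3%N (- (1 / 9)) isT.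
  move: phi0; clear; lra.
have S1 : window B n 0 0 <= \sum_(i < 4) window B n i i.
  rewrite !big_ord_recr big_ord0/=.
  have D i : (i < 4)%N -> _ := @psd_kernel_diag _ _ _ i BP.
  have := D 1%N isT; have := D 2%N isT; have := D 3%N isT.
  clear; lra.
rewrite M1 in G1.
have : tau * (Kform (window B n) - Kform (fun i j => window B n i.+1 j.+1)
    + (window B n 0 0) / 400) <=
    tau * (multiplier (window B n 0) - multiplier F + 400 * phi).
  by rewrite ler_pM2l//; move: K1 F1 S1; clear; lra.
move: G1; clear; lra.
Qed.

(** Testing with the newest value alone brings in only H-norms of the six previous values, so it is
    available right after the initial data. *)
Lemma bdf6_starting_step (R : realFieldType) (n : nat) (tau phi F : R)
    (H : nat -> nat -> R) (b : R) :
  0 < tau -> 0 <= phi -> 0 <= b -> psd_kernel 7 (window H n) ->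
  tau^-1 * bdf6 (fun i => window H n i 0) + b = F ->
  F <= b / 400 + 100 * phi ->
  H n n + tau * b <=
  200 * (\sum_(i < 6) H (n - i.+1)%N (n - i.+1)%N + tau * phi).
Proof.
move=> tau0 phi0 b0 HP eqF leF.
have D1 : bdf6 (fun i => window H n i 0) = tau * (F - b).
  by rewrite -eqF addrK mulrA divff ?mul1r// gt_eqF.
have D2 : tau * (F - b) <= tau * (100 * phi - 399 / 400 * b).
  by rewrite ler_pM2l//; move: leF; clear; lra.
have tb : 0 <= tau * b by rewrite mulr_ge0// ltW.
have tp : 0 <= tau * phi by rewrite mulr_ge0// ltW.
move: D1; rewrite /bdf6 => D1.
have HE i : H (n - i.+1)%N (n - i.+1)%N = window H n i.+1 i.+1 by [].
rewrite !big_ord_recr big_ord0/= !HE.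
have -> : H n n = window H n 0 0 by rewrite /window subn0.
(* The sign of the weight 20 is that of the BDF coefficient. The cross terms then cost about 25.3/40
   of [H n n], less than its coefficient 147/60. *)
have Y i a : (i < 7)%N -> _ :=
  fun i7 => psd_kernel_young a 1 HP i7 (isT : 0 < 7)%N.
have := Y 1%N (- 20) isT; have := Y 2%N 20 isT; have := Y 3%N (- 20) isT.
have := Y 4%N 20 isT; have := Y 5%N (- 20) isT; have := Y 6%N 20 isT.
have D i : (i < 7)%N -> _ := @psd_kernel_diag _ _ _ i HP.
have := D 0%N isT; have := D 1%N isT; have := D 2%N isT; have := D 3%N isT.
have := D 4%N isT; have := D 5%N isT; have := D 6%N isT.
move: D1 D2 tb tp; clear; lra.
Qed.

(** The predecessors of steps 7 and 8 are initial values or earlier starting steps, and the latter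
    satisfy [H n n <= W n] because [B] is nonnegative. *)
Lemma bdf6_starting_energy (R : realFieldType) (N : nat) (P : R)
    (H B : nat -> nat -> R) (W := fun n => H n n + B n n) :
  (6 <= N)%N -> 0 <= P -> (forall n, (n <= N)%N -> 0 <= H n n) ->
  (forall n, (6 <= n <= N)%N -> 0 <= B n n) ->
  (forall n, (6 <= n <= N)%N ->
     W n <= 200 * (\sum_(i < 6) H (n - i.+1)%N (n - i.+1)%N + P)) ->
  let S := \sum_(i < 6) H i i in
  [/\ W 6%N <= 200 * (S + P),
      (7 <= N)%N -> W 7%N <= 200 * (S + W 6%N + P) &
      (8 <= N)%N -> W 8%N <= 200 * (S + W 6%N + W 7%N + P)].
Proof.
move=> N6 P0 H0 B0 WP /=.
rewrite !big_ord_recr big_ord0/=.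
have D i : (i < 6)%N -> 0 <= H i i by move=> i6; apply/H0/ltnW/(leq_trans i6).
have D0 := D 0%N isT; have D1 := D 1%N isT.
split=> [|N7|N8].
- have := WP 6%N; rewrite N6 !big_ord_recr big_ord0/= => /(_ isT).
  rewrite /W !subnE/=; move: P0; clear; lra.
- have := WP 7%N; rewrite N7 !big_ord_recr big_ord0/= => /(_ isT).
  have := B0 6%N; rewrite N6 => /(_ isT).
  rewrite /W !subnE/=; move: P0 D0; clear; lra.
- have := WP 8%N; rewrite N8 !big_ord_recr big_ord0/= => /(_ isT).
  have := B0 6%N; rewrite N6 => /(_ isT).
  have := B0 7%N; rewrite (ltnW N8) => /(_ isT).
  rewrite /W !subnE/=; move: P0 D0 D1; clear; lra.
Qed.

Lemma sum_telescope_le (R : realFieldType) (m n : nat) (E a b : nat -> R) :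
  (m <= n)%N ->
  (forall k, (m < k <= n)%N -> E k + a k <= E k.-1 + b k) ->
  E n + \sum_(m.+1 <= k < n.+1) a k <= E m + \sum_(m.+1 <= k < n.+1) b k.
Proof.
move=> mn; elim: n mn => [|n IHn].
  by rewrite leqn0 => /eqP-> _; rewrite !big_geq// !addr0.
rewrite leq_eqVlt => /predU1P[-> _|mn step]; first by rewrite !big_geq// !addr0.
rewrite [in leLHS]big_nat_recr//= [in leRHS]big_nat_recr//=.
have := IHn mn (fun k kn => step k ltac:(lia)); have := step n.+1 ltac:(lia).
clear; rewrite /=; lra.
Qed.

(** Bounds the energy from which the telescoping sum starts; 2 is enlarged to 40 in the [Kform] part
    to share one factor. *)
Lemma bdf6_energy_bounded (R : realFieldType) (tau : R)
    (g b : nat -> nat -> R) :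
  0 < tau -> psd_kernel 6 g -> psd_kernel 3 b ->
  Gform g + tau * Kform b <=
  40 * (\sum_(i < 6) g i i + tau * \sum_(i < 3) b i i).
Proof.
move=> tau0 gP bP; have GP := Gform_bounded gP.
have KP : tau * Kform b <= tau * (40 * \sum_(i < 3) b i i).
  rewrite ler_pM2l//; apply: le_trans (Kform_bounded bP) _.
  rewrite ler_wpM2r ?ler_nat//; apply: sumr_ge0 => i _.
  exact: psd_kernel_diag bP (ltn_ord i).
by move: GP KP; clear; lra.
Qed.

(** [B] is controlled only at indices from 6 on, hence [6 + r <= n]. The starting steps cost a
    factor 201^3, the energy at step 8 a factor 40, and dividing by 1/40 and 1/400 a factor 440:
    about 1.5 * 10^11 in all. *)
Lemma bdf6_energy (R : realFieldType) (N : nat) (tau : R)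
    (H B F : nat -> nat -> R) (phi : nat -> R) :
  0 < tau -> (6 <= N)%N -> (forall n, 0 <= phi n) ->
  (forall n, (n <= N)%N -> psd_kernel 7 (window H n)) ->
  (forall n r, (6 + r <= n <= N)%N -> psd_kernel r.+1 (window B n)) ->
  (forall n m, (6 <= n <= N)%N -> (6 <= m <= n)%N ->
     tau^-1 * bdf6 (fun i => H (n - i)%N m) + B n m = F n m) ->
  (forall n m x, (6 <= n <= N)%N -> (6 <= m <= n)%N ->
     x * F n m <= B m m / 400 + 100 * x ^+ 2 * phi n) ->
  H N N + tau * \sum_(6 <= n < N.+1) B n n <=
  10 ^+ 12 * (\sum_(i < 6) H i i + tau * \sum_(6 <= n < N.+1) phi n).
Proof.
move=> tau0 N6 phi0 HP BP eqF leF.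
have H0 n : (n <= N)%N -> 0 <= H n n.
  move=> nN; have := psd_kernel_diag (HP n nN) (isT : 0 < 7)%N.
  by rewrite /window subn0.
have B0 n : (6 <= n <= N)%N -> 0 <= B n n.
  move=> nN; have := psd_kernel_diag (BP n 0%N nN) (isT : 0 < 1)%N.
  by rewrite /window subn0.
have tB0 n : (6 <= n <= N)%N -> 0 <= tau * B n n.
  by move=> /B0; exact/mulr_ge0/ltW.
set P := tau * \sum_(6 <= n < N.+1) phi n.
have P0 : 0 <= P by rewrite mulr_ge0 ?sumr_ge0// ltW.
have P1 n : (6 <= n <= N)%N -> tau * phi n <= P.
  move=> /andP[n6 nN]; rewrite ler_pM2l//.
  rewrite (@big_cat_nat _ _ _ n)//=; last exact: leqW.
  by rewrite [X in _ + X]big_ltn// addrCA lerDl addr_ge0 ?sumr_ge0.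
have start n : (6 <= n <= N)%N -> H n n + tau * B n n <=
    200 * (\sum_(i < 6) H (n - i.+1)%N (n - i.+1)%N + P).
  move=> nN; have nn : (6 <= n <= n)%N by rewrite leqnn; case/andP: nN => ->.
  have nleN : (n <= N)%N by case/andP: nN.
  have st := @bdf6_starting_step R n tau (phi n) (F n n) H (B n n).
  apply: le_trans (st tau0 (phi0 n) (B0 n nN) (HP n nleN) _ _) _.
  - by rewrite -(eqF n n)// /window subn0.
  - by have := leF n n 1 nN nn; rewrite mul1r expr1n mulr1.
  - by rewrite ler_wpM2l ?ler0n// lerD2l P1.
have [] := @bdf6_starting_energy R N P H (fun i j => tau * B i j)
  N6 P0 H0 tB0 start.
set S := \sum_(i < 6) H i i; move=> X6 X7 X8.
have S0 : 0 <= S.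
  by rewrite sumr_ge0// => i _; apply/H0/ltnW/(leq_trans (ltn_ord i)).
have T0 : 0 <= S + P by rewrite addr_ge0.
have H6 := H0 6%N N6.
(* Up to step 8 the starting estimates alone suffice; the multiplier takes over at step 9. *)
case: (ltngtP N 8) => [N8|N9|N8].
- have [N6'|N7'] : N = 6%N \/ N = 7%N by clear -N6 N8; lia.
    rewrite N6' big_nat1; move: T0 X6; clear; lra.
  have := X7 (eq_leq (esym N7')); move: T0 X6 H6.
  by rewrite N7' big_ltn// big_nat1; clear; lra.
- have N78 := ltnW N9; have N77 := ltnW N78.
  have step n : (8 < n <= N)%N ->
      Gform (window H n) + tau * Kform (window B n) + tau / 400 * B n n <=
      Gform (window H n.-1) + tau * Kform (window B n.-1) + 400 * (tau * phi n).
    move=> /andP[n9 nN]; have n6 : (6 <= n)%N by exact: leq_trans n9.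
    (* Since n >= 9, the window of four reaches back no further than step 6. *)
    have HPn := HP n nN; have BPn : psd_kernel 4 (window B n).
      by apply: BP; rewrite n9.
    apply: (bdf6_energy_step tau0 (phi0 n) HPn BPn
              (F := fun j => F n (n - j)%N)) => j.
      move=> j4; have nj : (6 <= n - j <= n)%N by clear -n9 j4; lia.
      by rewrite -(eqF n (n - j)%N) ?n6// /window subn0.
    move=> x j4; have nj : (6 <= n - j <= n)%N by clear -n9 j4; lia.
    by apply: leF; rewrite ?n6.
  have := sum_telescope_le
    (E := fun n => Gform (window H n) + tau * Kform (window B n))
    (a := fun n => tau / 400 * B n n) (b := fun n => 400 * (tau * phi n))
    N78 step.
  rewrite -!mulr_sumr => telescoped.
  have EN : Gform (window H N) + tau * Kform (window B N)
        + tau / 400 * \sum_(9 <= n < N.+1) B n n <=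
      Gform (window H 8) + tau * Kform (window B 8)
        + 400 * (tau * \sum_(9 <= n < N.+1) phi n) by exact: telescoped.
  have E8 : Gform (window H 8) + tau * Kform (window B 8) <=
      40 * (H 8%N 8%N + H 7%N 7%N + H 6%N 6%N + H 5%N 5%N + H 4%N 4%N
            + H 3%N 3%N
            + tau * (B 8%N 8%N + B 7%N 7%N + B 6%N 6%N)).
    have := bdf6_energy_bounded tau0
      (psd_kernel_le (isT : 6 <= 7)%N (HP 8%N N78)) (BP 8%N 2%N N78).
    by rewrite !big_ord_recr !big_ord0/= !add0r.
  have GN := Gform_coercive (psd_kernel_le (isT : 6 <= 7)%N (HP N (leqnn N))).
  have KN : 0 <= tau * Kform (window B N).
    by rewrite mulr_ge0 ?(ltW tau0)// Kform_ge0//; apply: BP; rewrite N9 leqnn.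
  have PN : tau * \sum_(9 <= n < N.+1) phi n <= P.
    rewrite ler_pM2l// [leRHS](@big_cat_nat _ _ _ 9)//=.
    by rewrite lerDr sumr_ge0.
  have BE : \sum_(6 <= n < N.+1) B n n =
      B 6%N 6%N + (B 7%N 7%N + (B 8%N 8%N + \sum_(9 <= n < N.+1) B n n)).
    by rewrite big_ltn 1?leqW// big_ltn 1?leqW// big_ltn 1?leqW.
  have SE : S = H 0%N 0%N + H 1%N 1%N + H 2%N 2%N + H 3%N 3%N + H 4%N 4%N
      + H 5%N 5%N.
    by rewrite /S !big_ord_recr big_ord0/= add0r.
  have {}GN : H N N / 40 <= Gform (window H N).
    by move: GN; rewrite {1}/window subn0.
  have := H0 0%N isT; have := H0 1%N (ltnW (ltnW (ltnW (ltnW (ltnW N6))))).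
  have := H0 2%N (ltnW (ltnW (ltnW (ltnW N6)))).
  move: EN E8 GN KN PN S0 X6 (X7 N77) (X8 N78) P0 H6.
  move: (H0 7%N N77) (H0 8%N N78) (H0 N (leqnn N)).
  rewrite BE SE.
  move: (Gform (window H N)) (Kform (window B N)) => ? ?.
  move: (Gform (window H 8)) (Kform (window B 8)) => ? ?.
  clear; lra.
- have := X8 (eq_leq (esym N8)); have := X7 (ltnW (eq_leq (esym N8))).
  have := H0 7%N (ltnW (eq_leq (esym N8))); move: T0 X6 H6.
  by rewrite N8 big_ltn// big_ltn// big_nat1; clear; lra.
Qed.

(** * Forms that are bilinear only on a subset *)

(** Integrals and [j] are linear only on suitable functions, so linearity is relative to [S]. The
    sums are nonempty because 0 is not assumed to lie in [S]. *)
Lemma linear_on_sum (R : realType) (E : lmodType R) (S : set E) (b : E -> R) :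
  (forall a x y, S x -> S y -> S (a *: x + y)) ->
  (forall a x y, S x -> S y -> b (a *: x + y) = a * b x + b y) ->
  forall m (c : nat -> R) (v : nat -> E), (forall i, (i <= m)%N -> S (v i)) ->
  S (\sum_(i < m.+1) c i *: v i) /\
  b (\sum_(i < m.+1) c i *: v i) = \sum_(i < m.+1) c i * b (v i).
Proof.
move=> SD bD m c v; elim: m => [|m IHm] Sv.
  have Sv0 := Sv 0%N isT.
  (* Brings a lone multiple into the shape [a *: x + y], the only one under which [S] is closed. *)
  have -> : \sum_(i < 1) c i *: v i = (c 0%N - 1) *: v 0%N + v 0%N.
    by rewrite big_ord1 scalerBl scale1r subrK.
  by split; [exact: SD|rewrite bD// big_ord1; ring].
have [Ss bs] := IHm (fun i im => Sv i (leqW im)).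
have Svm := Sv m.+1 (leqnn _).
rewrite big_ord_recr/= addrC; split; first exact: SD.
by rewrite bD// bs addrC [RHS]big_ord_recr.
Qed.

(** The quadratic form at [c] is the value of [B] on the diagonal at the combination of the [v i]
    with coefficients [c i]. *)
Lemma psd_kernel_gram (R : realType) (E : lmodType R) (S : set E)
    (B : E -> E -> R) :
  (forall a x y, S x -> S y -> S (a *: x + y)) ->
  (forall a x y z, S x -> S y -> S z -> B (a *: x + y) z = a * B x z + B y z) ->
  (forall x y, S x -> S y -> B x y = B y x) ->
  (forall x, S x -> 0 <= B x x) ->
  forall m (v : nat -> E), (forall i, (i < m)%N -> S (v i)) ->
  psd_kernel m (fun i j => B (v i) (v j)).
Proof.
move=> SD BD Bs B0 m v Sv; split=> [i j im jm|c].
  exact: Bs (Sv _ im) (Sv _ jm).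
case: m Sv => [|m] Sv; first by rewrite big_ord0.
have lin z : S z -> _ := fun Sz => linear_on_sum (b := B ^~ z) SD
  (fun a x y Sx Sy => BD a x y z Sx Sy Sz) c Sv.
have [Sw _] := lin _ (Sv 0%N isT).
have := B0 _ Sw; rewrite (lin _ Sw).2; congr (_ <= _); apply: eq_bigr => i _.
rewrite Bs//; last exact: Sv.
rewrite (lin _ (Sv i (ltn_ord i))).2 mulr_sumr; apply: eq_bigr => j _.
by rewrite mulrA (Bs (v i))//; apply: Sv.
Qed.

(** * Square-integrable functions and discrete pressures *)

Section L2_theory.
Context (R : realType) (d : nat) (Omega : set 'rV[R]_d).
Context (mO : measurable Omega).
Local Notation mu := (lebesgue_rV R d).

Lemma L2_integrable_sqr f : L2 Omega f ->
  mu.-integrable Omega (EFin \o (fun x => f x ^+ 2)).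
Proof.
move=> [mf foo]; apply/integrableP; split.
  by apply/measurable_EFinP; exact: measurable_funX.
by under eq_integral do rewrite gee0_abs ?lee_fin ?sqr_ge0//.
Qed.

(** By comparison, as |f g| <= f^2 + g^2. *)
Lemma L2_integrableM f g : L2 Omega f -> L2 Omega g ->
  mu.-integrable Omega (EFin \o (fun x => f x * g x)).
Proof.
move=> Lf Lg.
have := integrableD mO (L2_integrable_sqr Lf) (L2_integrable_sqr Lg).
apply: le_integrable => //.
  by apply/measurable_EFinP; apply: measurable_funM; [case: Lf|case: Lg].
move=> x _ /=; rewrite lee_fin [leRHS]ger0_norm ?addr_ge0 ?sqr_ge0//.
have := sqr_ge0 (f x - g x); have := sqr_ge0 (f x + g x).
have := sqr_ge0 (f x); have := sqr_ge0 (g x).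
by move=> ? ? ? ?; rewrite ler_norml; apply/andP; split; nra.
Qed.

Lemma L2D a f g : L2 Omega f -> L2 Omega g -> L2 Omega (a *: f + g).
Proof.
move=> Lf Lg; have [mf _] := Lf; have [mg _] := Lg; split.
  by apply: measurable_funD => //; exact: measurable_funM.
have i1 := L2_integrable_sqr Lf; have i2 := L2_integrableM Lf Lg.
have i3 := L2_integrable_sqr Lg.
have i4 := integrableD mO (integrableD mO (integrableZl mO (a ^+ 2) i1)
  (integrableZl mO (2 * a) i2)) i3.
have /integrableP[_] := i4.
congr (_ < _)%E; apply: eq_integral => x _ /=.
have -> : (a *: f + g) x = a * f x + g x by [].
have E : a ^+ 2 * f x ^+ 2 + 2 * a * (f x * g x) + g x ^+ 2 =
    (a * f x + g x) ^+ 2 by ring.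
by rewrite E ger0_norm ?sqr_ge0.
Qed.

Lemma ipL2C f g : ipL2 Omega f g = ipL2 Omega g f.
Proof. by apply: eq_Rintegral => x _; rewrite mulrC. Qed.

Lemma ipL2Dl a f g h : L2 Omega f -> L2 Omega g -> L2 Omega h ->
  ipL2 Omega (a *: f + g) h = a * ipL2 Omega f h + ipL2 Omega g h.
Proof.
move=> Lf Lg Lh; rewrite /ipL2 -RintegralZl//; last exact: L2_integrableM.
rewrite -RintegralD//; last exact: L2_integrableM.
  apply: eq_Rintegral => x _.
  by rewrite (_ : (a *: f + g) x = a * f x + g x)// mulrDl mulrA.
have := integrableZl mO a (L2_integrableM Lf Lh).
by apply: eq_integrable.
Qed.

Lemma ipL2_ge0 f : 0 <= ipL2 Omega f f.
Proof. by apply: Rintegral_ge0 => x _; rewrite -expr2 sqr_ge0. Qed.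

Lemma psd_kernel_ipL2 m (v : nat -> 'rV[R]_d -> R) :
  (forall i, (i < m)%N -> L2 Omega (v i)) ->
  psd_kernel m (fun i j => ipL2 Omega (v i) (v j)).
Proof.
apply: psd_kernel_gram => [a f g|a f g h|f g _ _|f _].
- exact: L2D.
- exact: ipL2Dl.
- exact: ipL2C.
- exact: ipL2_ge0.
Qed.

End L2_theory.

(** A bounded set lies in a cube, whose measure is known from [lebesgue_rV_box]. *)
Lemma bounded_lebesgue_rV_lty (R : realType) d (Omega : set 'rV[R]_d) :
  measurable Omega -> bounded_set Omega -> (lebesgue_rV R d Omega < +oo)%E.
Proof.
move=> mO /ex_strict_bound_gt0[M M0 OM].
pose a : 'rV[R]_d := const_mx (- M); pose b : 'rV[R]_d := const_mx M.
have ab i j : a i j <= b i j by rewrite !mxE ge0_cp// ltW.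
apply: (@le_lt_trans _ _ (lebesgue_rV R d
    [set x | forall i j, a i j <= x i j <= b i j])); last first.
  by rewrite lebesgue_rV_box// ltry.
apply: le_measure; rewrite ?inE//; first exact: measurable_box.
move=> x /OM /= xM i j; rewrite !mxE -ler_norml; apply/ltW/(le_lt_trans _ xM).
rewrite [leRHS]mx_normrE.
exact: (le_bigmax _ (fun ij => `|x ij.1 ij.2|) (i, j)).
Qed.

Lemma L2_cst1 (R : realType) d (Omega : set 'rV[R]_d) :
  measurable Omega -> bounded_set Omega -> L2 Omega (fun=> 1).
Proof.
move=> mO bO; split; first exact: measurable_cst.
under eq_integral do rewrite expr1n.
by rewrite integral_cst// mul1e; exact: bounded_lebesgue_rV_lty.
Qed.

(** The integral is the L2 product with the constant 1, which is in L2 on a bounded set. This makes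
    the zero-mean condition on pressures linear. *)
Lemma Rintegral_L2D (R : realType) d (Omega : set 'rV[R]_d) a f g :
  measurable Omega -> bounded_set Omega -> L2 Omega f -> L2 Omega g ->
  \int[lebesgue_rV R d]_(x in Omega) (a *: f + g) x =
  a * \int[lebesgue_rV R d]_(x in Omega) f x
  + \int[lebesgue_rV R d]_(x in Omega) g x.
Proof.
move=> mO bO Lf Lg; have L1 := L2_cst1 mO bO.
have E (h : 'rV[R]_d -> R) :
    \int[lebesgue_rV R d]_(x in Omega) h x = ipL2 Omega h (fun=> 1).
  by apply: eq_Rintegral => x _; rewrite mulr1.
by rewrite !E ipL2Dl.
Qed.

Lemma polynomial_functionD (R : realType) d k a (p q : 'rV[R]_d -> R) :
  polynomial_function k p -> polynomial_function k q ->
  polynomial_function k (a *: p + q).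
Proof.
move=> [c pE] [c' qE]; exists (fun al => a * c al + c' al) => x.
rewrite (_ : (a *: p + q) x = a * p x + q x)// pE qE mulr_sumr -big_split/=.
by apply: eq_bigr => i _; rewrite mulrDl mulrA.
Qed.

Lemma spaceQhD (R : realType) d (Omega : set 'rV[R]_d) T cp l a p q :
  measurable Omega -> bounded_set Omega ->
  spaceQh Omega T cp l p -> spaceQh Omega T cp l q ->
  spaceQh Omega T cp l (a *: p + q).
Proof.
move=> mO bO [[[Lp Pp] [_ Ip]] Cp] [[[Lq Pq] [_ Iq]] Cq].
have L : L2 Omega (a *: p + q) by exact: L2D.
split; first (split; split => //).
- move=> K KT; have [p' Pp' Ep] := Pp K KT; have [q' Pq' Eq] := Pq K KT.
  exists (a *: p' + q'); first exact: polynomial_functionD.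
  by move=> x Kx; rewrite -[LHS]/(a * p x + q x) Ep// Eq.
- by rewrite Rintegral_L2D// Ip Iq mulr0 addr0.
- move=> /= c; apply/subspace_continuousP => x Ox.
  have /subspace_continuousP/(_ x Ox) cp_x := Cp c.
  have /subspace_continuousP/(_ x Ox) cq_x := Cq c.
  rewrite /from_subspace in cp_x cq_x *.
  apply: (@cvgD _ _ _ _ _ (a *: p) q); last exact: cq_x.
  exact: cvgM (cvg_cst a) cp_x.
Qed.

(** Pascal's rule gives the coefficients of (1 - X)^m, so delta_i is the sum over m of (-1)^i C(m,
    i) / m. *)
Lemma bdf_coefE (R : realType) (x : nat -> R) :
  \sum_(i < 7) bdf_coef R 6 i * x i = bdf6 x.
Proof.
have E m i : ((1 - 'X) ^+ m : {poly R})`_i = (-1) ^+ i *+ 'C(m, i).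
  elim: m i => [|m IHm] i; first by rewrite expr0 coef1; case: i.
  rewrite exprS mulrBl mul1r coefB coefXM.
  case: i => [|i] /=; first by rewrite subr0 IHm !bin0.
  by rewrite !IHm binS mulrnDr [X in _ + X *+ _]exprS mulN1r mulNrn.
have bE i : bdf_coef R 6 i =
    \sum_(m < 6) m.+1%:R^-1 * ((-1) ^+ i *+ 'C(m.+1, i)).
  rewrite /bdf_coef /bdf_poly coef_sum big_add1 big_mkord.
  by apply: eq_bigr => m _; rewrite coefZ E.
rewrite !big_ord_recr big_ord0/= !bE !big_ord_recr !big_ord0 /binomial /bdf6/=.
by field.
Qed.

(** * Velocity forms and the Poincaré inequality *)

Section velocity.
Context (R : realType) (d : nat) (Omega : set 'rV[R]_d).
Context (mO : measurable Omega).
Implicit Types u v w : vfield R d.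

Lemma spaceHD a u v :
  spaceH Omega u -> spaceH Omega v -> spaceH Omega (a *: u + v).
Proof. by move=> Hu Hv i; exact: L2D. Qed.

Lemma ipHDl a u v w : spaceH Omega u -> spaceH Omega v -> spaceH Omega w ->
  ipH Omega (a *: u + v) w = a * ipH Omega u w + ipH Omega v w.
Proof.
move=> Hu Hv Hw; rewrite /ipH mulr_sumr -big_split; apply: eq_bigr => i _.
exact: (ipL2Dl mO a (Hu i) (Hv i) (Hw i)).
Qed.

Lemma ipHC u v : ipH Omega u v = ipH Omega v u.
Proof. by apply: eq_bigr => i _; exact: ipL2C. Qed.

Lemma ipH_ge0 u : 0 <= ipH Omega u u.
Proof. by apply: sumr_ge0 => i _; exact: ipL2_ge0. Qed.

Lemma sqr_normH u : normH Omega u ^+ 2 = ipH Omega u u.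
Proof. by rewrite sqr_sqrtr ?ipH_ge0. Qed.

Lemma psd_kernel_ipH m (u : nat -> vfield R d) :
  (forall i, (i < m)%N -> spaceH Omega (u i)) ->
  psd_kernel m (fun i j => ipH Omega (u i) (u j)).
Proof.
apply: psd_kernel_gram => [a f g|a f g h|f g _ _|f _].
- exact: spaceHD.
- exact: ipHDl.
- exact: ipHC.
- exact: ipH_ge0.
Qed.

Lemma ipH_bdf_derivative (tau : R) (u : nat -> vfield R d) n v :
  (forall i, (i <= n)%N -> spaceH Omega (u i)) -> spaceH Omega v ->
  ipH Omega (bdf_derivative 6 tau u n) v =
  tau^-1 * bdf6 (fun i => ipH Omega (u (n - i)%N) v).
Proof.
move=> Hu Hv; have ipHD a x y Hx Hy := @ipHDl a x y v Hx Hy Hv.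
have [Hs bs] := linear_on_sum (b := (ipH Omega) ^~ v) spaceHD ipHD (m := 6)
  (bdf_coef R 6) (fun i _ => Hu (n - i)%N (leq_subr i n)).
rewrite -bdf_coefE -bs /bdf_derivative; move: Hs; set s := \sum_(i < 7) _ => Hs.
have -> : tau^-1 *: s = (tau^-1 - 1) *: s + s by rewrite scalerBl scale1r subrK.
by rewrite ipHD//; ring.
Qed.

(** A sum, over all components of the gradient, of L2 Gram matrices scaled by [nu]. *)
Lemma psd_kernel_form_a (nu : R) m (u : nat -> h1field R d) :
  0 <= nu -> (forall i, (i < m)%N -> spaceV Omega (u i)) ->
  psd_kernel m (fun i j => form_a Omega nu (u i) (u j)).
Proof.
move=> nu0 Vu; apply: psd_kernel_sum => i _; apply: psd_kernel_sum => k _.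
have L n : (n < m)%N -> L2 Omega ((u n).2 i k) by move=> nm; case: (Vu n nm i).
have [gs gP] := psd_kernelZ nu0 (psd_kernel_ipL2 mO L).
have E n n' : (n < m)%N -> (n' < m)%N ->
    ipL2 Omega (nu *: (u n).2 i k) ((u n').2 i k) =
    nu * ipL2 Omega ((u n).2 i k) ((u n').2 i k).
  move=> nm n'm.
  have -> : nu *: (u n).2 i k = (nu - 1) *: (u n).2 i k + (u n).2 i k.
    by rewrite scalerBl scale1r subrK.
  by rewrite (ipL2Dl mO)//; [ring|exact: L|exact: L|exact: L].
split=> [n n' nm n'm|c]; first by rewrite !E// gs.
have := gP c; congr (_ <= _); apply: eq_bigr => n _; apply: eq_bigr => n' _.
by rewrite E.
Qed.

Lemma form_a_ge0 (nu : R) (u : h1field R d) :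
  0 <= nu -> spaceV Omega u -> 0 <= form_a Omega nu u u.
Proof.
move=> nu0 Vu.
exact: (@psd_kernel_diag _ 1 _ 0 (psd_kernel_form_a nu0 (fun i _ => Vu)) isT).
Qed.

(** With s = cP / sqrt nu, Young's inequality leaves |u|_H^2 / (400 s^2), at most |u|_V^2 / 400. The
    weight 1/400 is the one that [bdf6_energy] can absorb. *)
Lemma poincare_young (nu cP x : R) f (u : h1field R d) :
  0 < nu -> poincare_constant Omega nu cP -> spaceH Omega f -> spaceV Omega u ->
  x * ipH Omega f u.1 <=
  form_a Omega nu u u / 400 + 100 * x ^+ 2 * (cP ^+ 2 / nu * ipH Omega f f).
Proof.
move=> nu0 [cP0 cPV] Hf Vu.
have Hu : spaceH Omega u.1 by move=> i; case: (Vu i).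
have nu_ge0 := ltW nu0; have a0 := form_a_ge0 nu_ge0 Vu.
pose s := cP * (Num.sqrt nu)^-1.
have s0 : 0 < s by rewrite mulr_gt0// invr_gt0 sqrtr_gt0.
have ss : s ^+ 2 = cP ^+ 2 / nu by rewrite exprMn exprVn sqr_sqrtr.
have uu : ipH Omega u.1 u.1 <= s ^+ 2 * form_a Omega nu u u.
  rewrite -sqr_normH -[form_a _ _ _ _](sqr_sqrtr a0) -exprMn.
  apply: lerXn2r; rewrite ?nnegrE ?mulr_ge0 ?invr_ge0 ?sqrtr_ge0 ?(ltW cP0)//.
  exact: cPV Vu.
have fuP : psd_kernel 2
    (fun i j => ipH Omega (nth f [:: f; u.1] i) (nth f [:: f; u.1] j)).
  by apply: psd_kernel_ipH => -[|[|]].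
(* The weights satisfy 2ab = -x, a^2 = 100 x^2 s^2 and b^2 = 1 / (400 s^2). *)
have := psd_kernel_young (- (10 * x * s)) (20 * s)^-1 fuP
  (isT : 0 < 2)%N (isT : 1 < 2)%N.
rewrite /= -ss => H.
have s_neq0 : s != 0 by rewrite gt_eqF.
have E : - (2 * - (10 * x * s) * (20 * s)^-1 * ipH Omega f u.1) =
    x * ipH Omega f u.1.
  by field.
rewrite -E; apply: le_trans H _; rewrite addrC lerD//;
  last by rewrite sqrrN; lra.
rewrite (_ : _ / 400 = (20 * s)^-1 ^+ 2 * (s ^+ 2 * form_a Omega nu u u)).
  by rewrite ler_wpM2l ?sqr_ge0.
by field.
Qed.

End velocity.

(** * Stability of the fully discrete scheme *)

Unset Implicit Arguments.

Theorem theorem5p1 (R : realType) (d : nat) (hd : d = 2%N \/ d = 3%N)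
    (Omega : set 'rV[R]_d) (hOmega : lipschitz_domain Omega)
    (nu : R) (hnu : 0 < nu)
    (cP : R) (hcP : poincare_constant Omega nu cP)
    (Th : R -> seq 'M[R]_(d.+1, d)) (hTh : quasi_uniform Omega Th)
    (k l lbar : nat) (hk : (1 <= k)%N) (hkl : (k - 1 <= l <= k)%N)
    (hlbar : (1 <= lbar)%N) (continuous_pressure : bool)
    (j : R -> ('rV[R]_d -> R) -> ('rV[R]_d -> R) -> R)
    (hj : pressure_stabilization Omega nu
            (fun h => spaceQh Omega (Th h) continuous_pressure l) j)
    (hI : quasi_interpolation Omega nu k l lbar
            (fun h => spaceVh Omega (Th h) k)
            (fun h => spaceQh Omega (Th h) continuous_pressure l) j) :
  exists2 C : R, 0 < C &
  forall (h : R), 0 < h <= 1 ->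
  forall (T : R) (M N : nat) (tau : R),
    0 < T -> (0 < M)%N -> tau = T / M%:R ->
    (6 <= N)%N -> 0 <= N%:R * tau <= T ->
  forall (f : R -> vfield R d), continuous_in_H Omega T f ->
  forall (u : nat -> h1field R d) (p : nat -> 'rV[R]_d -> R),
    bdf_solution Omega nu 6 (spaceVh Omega (Th h) k)
      (spaceQh Omega (Th h) continuous_pressure l) (j h) tau N f u p ->
    normH Omega (u N).1 ^+ 2
      + norm_ell2 6 N tau (fun n => normV Omega nu (u n)) ^+ 2
      + norm_ell2 6 N tau (fun n => seminorm_j (j h) (p n)) ^+ 2
    <= C * (\sum_(i < 6) normH Omega (u i).1 ^+ 2
            + cP ^+ 2 / nu
              * norm_ell2 6 N tau (fun n => normH Omega (f (n%:R * tau))) ^+ 2).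
Proof.
have [_ oO _ bO _] := hOmega.
have mO : measurable Omega := open_measurable_mx oO.
have [jD jC j_ge0 _] := hj.
(* The constant of [bdf6_energy], free of all data. *)
exists (10 ^+ 12) => [|h h01 T M N tau T0 M0 tauE N6 /andP[_ NT]].
  by rewrite exprn_gt0.
move=> f [Hf _] u p [Vinit step].
have tau0 : 0 < tau by rewrite tauE divr_gt0// ltr0n.
have VhV n : (n <= N)%N -> spaceVh Omega (Th h) k (u n).
  move=> nN; have [n6|n6] := ltnP n 6; first exact: Vinit.
  by case: (step n); rewrite ?n6.
have Vu n : (n <= N)%N -> spaceV Omega (u n) by move=> /VhV[].
have Hu n : (n <= N)%N -> spaceH Omega (u n).1 by move=> /Vu V i; case: (V i).
have Qp n : (6 <= n <= N)%N -> spaceQh Omega (Th h) continuous_pressure l (p n).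
  by move=> /step[].
have Hfn n : (6 <= n <= N)%N -> spaceH Omega (f (n%:R * tau)).
  move=> /andP[_ nN]; apply: Hf; rewrite mulr_ge0 ?ler0n ?(ltW tau0)//=.
  by apply: le_trans NT; rewrite ler_wpM2r ?ler_nat// ltW.
have nu_ge0 := ltW hnu.
(* Pressures exist only from step 6 on, which [6 + r <= n] respects. *)
have jP n r : (6 + r <= n <= N)%N ->
    psd_kernel r.+1 (window (fun a b => j h (p a) (p b)) n).
  move=> nN.
  apply: (@psd_kernel_gram _ _ (spaceQh Omega (Th h) continuous_pressure l)
    (j h) _ _ _ _ _ (fun i => p (n - i)%N)).
  - by move=> a x y; exact: spaceQhD.
  - by move=> a x y z Qx Qy Qz; case: (jD h a x y z h01 Qx Qy Qz).
  - by move=> x y; exact: jC.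
  - by move=> x; exact: j_ge0.
  - by move=> i ir; apply: Qp; lia.
have aP n r : (6 + r <= n <= N)%N ->
    psd_kernel r.+1 (window (fun a b => form_a Omega nu (u a) (u b)) n).
  move=> nN; apply: (psd_kernel_form_a mO (u := fun i => u (n - i)%N)) => //.
  move=> i _.
  by apply: Vu; lia.
(* Viscous and stabilization energy are treated as one semi-inner product. *)
pose B a b := form_a Omega nu (u a) (u b) + j h (p a) (p b).
pose F a b := ipH Omega (f (a%:R * tau)) (u b).1.
have ell2 w : norm_ell2 6 N tau w ^+ 2 = tau * \sum_(6 <= n < N.+1) w n ^+ 2.
  rewrite sqr_sqrtr// mulr_ge0 ?(ltW tau0)// sumr_ge0// => i _.
  by rewrite sqr_ge0.
have := @bdf6_energy R N tau (fun a b => ipH Omega (u a).1 (u b).1) B F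
  (fun n => cP ^+ 2 / nu * ipH Omega (f (n%:R * tau)) (f (n%:R * tau))) tau0 N6.
rewrite !ell2 sqr_normH -addrA -mulrDr -big_split/=.
under [X in _ -> _ <= _ * (X + _)]eq_bigr do rewrite sqr_normH.
under [X in _ -> _ <= _ * (_ + _ * (_ * X))]eq_bigr do rewrite sqr_normH.
rewrite -mulr_sumr mulrCA.
have -> : \sum_(6 <= n < N.+1)
      (normV Omega nu (u n) ^+ 2 + seminorm_j (j h) (p n) ^+ 2) =
    \sum_(6 <= n < N.+1) B n n.
  apply: eq_big_nat => n nN; rewrite !sqr_sqrtr//.
    by apply: j_ge0 => //; exact: Qp.
  by apply: (form_a_ge0 mO) => //; apply: Vu; lia.
apply.
- by move=> n; rewrite mulr_ge0 ?ipH_ge0// divr_ge0// sqr_ge0.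
- move=> n nN; apply: (psd_kernel_ipH mO (u := fun i => (u (n - i)%N).1)).
  move=> i _.
  by apply: Hu; lia.
- by move=> n r nN; exact: psd_kernelD (aP n r nN) (jP n r nN).
- move=> n m nN mn; have [Vn Qn eq_u eq_p] := step n nN.
  have mN : (6 <= m <= N)%N by lia.
  have Hm : spaceH Omega (u m).1 by apply: Hu; lia.
  rewrite /F -(eq_u (u m)); last by apply: VhV; lia.
  rewrite (ipH_bdf_derivative mO)//; last by move=> i i_n; apply: Hu; lia.
  (* The continuity equation of step [m], tested with [p n], turns b(p^n, u^m) into j_h(p^n, p^m).
     It is available only for m >= 6, as the initial values need not satisfy it. *)
  have [_ _ _ eq_m] := step m mN.
  have /eqP := eq_m _ Qn; rewrite subr_eq0 => /eqP ->.
  by rewrite /B addrA jC//; exact: Qp.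
- move=> n m x nN mn; have mN : (6 <= m <= N)%N by lia.
  have Vm : spaceV Omega (u m) by apply: Vu; lia.
  apply: le_trans (poincare_young mO x hnu hcP (Hfn n nN) Vm) _.
  (* Adding the stabilization energy turns the viscous bound into one by [B m m]. *)
  have : 0 <= j h (p m) (p m) by apply: j_ge0 => //; exact: Qp.
  by rewrite /B; clear; lra.
Qed.
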